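(* Let $X$ be a proper, geodesically complete tree whose boundary $\partial X$ has at least four points. Then the visual embedding $i_X:X\to\mathcal{M}(\partial X)$, $x\mapsto\rho_x$, is an isometry (distance-preserving bijection).
   Context: A tree means a metric (real) tree, i.e. a geodesic metric space that is $0$-hyperbolic; it is CAT(-1). A space is proper if closed balls are compact, and geodesically complete if every geodesic segment extends to a bi-infinite geodesic. $(y|z)_x=\frac12(d(x,y)+d(x,z)-d(y,z))$ is the Gromov product; for a proper tree $X$ with visual (Gromov) boundary $\partial X$ and compactification $\overline X=X\cup\partial X$, it extends to a continuous function $(\cdot|\cdot)_x:\overline X\times\overline X\to[0,+\infty]$ for each $x\in X$, and $\rho_x(\xi,\eta)=e^{-(\xi|\eta)_x}$ for $\xi,\eta\in\partial X$. Antipodal spaces and Moebius spaces. Let $Z$ be a compact metrizable space containing at least four points. A separating function on $Z$ is a continuous function $\rho : Z\times Z\to[0,\infty)$ which is symmetric and satisfies $\rho(\xi,\eta)=0$ if and only if $\xi=\eta$. Its cross-ratio is defined on quadruples of distinct points of $Z$ by $[\xi,\xi',\eta,\eta']_\rho=\frac{\rho(\xi,\eta)\rho(\xi',\eta')}{\rho(\xi,\eta')\rho(\xi',\eta)}$. Two separating functions are Moebius equivalent if their cross-ratios agree. If $\rho_1,\rho_2$ are Moebius equivalent, there is a unique positive continuous function $\frac{d\rho_2}{d\rho_1}:Z\to(0,\infty)$, the derivative, such that $\rho_2(\xi,\eta)^2=\frac{d\rho_2}{d\rho_1}(\xi)\frac{d\rho_2}{d\rho_1}(\eta)\rho_1(\xi,\eta)^2$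 for all $\xi,\eta\in Z$. An antipodal function on $Z$ is a separating function $\rho$ such that $\sup_{\xi,\eta}\rho(\xi,\eta)=1$ and for every $\xi\in Z$ there is $\eta\in Z$ with $\rho(\xi,\eta)=1$. For an antipodal function $\rho_0$, the Moebius space $\mathcal{M}(Z)=\mathcal{M}(Z,\rho_0)$ is the set of all antipodal functions on $Z$ Moebius equivalent to $\rho_0$, with the metric $d_{\mathcal{M}}(\rho_1,\rho_2)=\left\|\log\frac{d\rho_2}{d\rho_1}\right\|_\infty$. For $X$ as in the statement, the functions $\rho_x$, $x\in X$, are antipodal functions on $\partial X$, all Moebius equivalent, and $\mathcal{M}(\partial X)=\mathcal{M}(\partial X,\rho_x)$ does not depend on $x$. *)

(* Defs.v *)
From HB Require Import structures.
From mathcomp Require Import all_boot all_order all_algebra.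
From mathcomp Require Import all_classical all_reals all_analysis.
Set Implicit Arguments.
Unset Strict Implicit.
Unset Printing Implicit Defensive.
Import Order.TTheory GRing.Theory Num.Theory.
Import numFieldNormedType.Exports.

Local Open Scope classical_set_scope.
Local Open Scope ring_scope.

Section MetricGeometry.
Context {R : realType} {X : metricType R}.
Implicit Types (I : set R) (c g : R -> X) (x y z w : X).

(* Paths are total functions on R; only their values on the relevant interval
   are meaningful. *)
Definition isometric_on I c : Prop :=
  forall s t, I s -> I t -> mdist (c s) (c t) = `|s - t|.

Definition is_ray c : Prop := isometric_on `[0, +oo[ c.

Definition gromov_product x y z : R :=
  (mdist x y + mdist x z - mdist y z) / 2.

End MetricGeometry.

Section TreePredicates.
Context {R : realType}.
Variable X : metricType R.

Definition geodesic_space : Prop :=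
  forall x y : X, exists c : R -> X,
    [/\ isometric_on `[0, mdist x y] c, c 0 = x & c (mdist x y) = y].

Definition zero_hyperbolic : Prop :=
  forall w x y z : X,
    Num.min (gromov_product w x y) (gromov_product w y z)
      <= gromov_product w x z.

Definition metric_tree : Prop := geodesic_space /\ zero_hyperbolic.

Definition proper_space : Prop :=
  forall (x : X) (r : R), compact [set y | mdist x y <= r].

Definition geodesically_complete : Prop :=
  forall (a b : R) (c : R -> X), a <= b -> isometric_on `[a, b] c ->
    exists2 g : R -> X, isometric_on setT g & {in `[a, b], c =1 g}.

End TreePredicates.

Definition asymptotic {R : realType} {X : metricType R} (c g : R -> X) : Prop :=
  exists K : R, forall t, 0 <= t -> mdist (c t) (g t) <= K.

Record boundary {R : realType} (X : metricType R) := Boundary {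
  rays_to : set (R -> X);
  rays_to_class : exists2 c, is_ray c &
    rays_to = [set g | is_ray g /\ asymptotic c g] }.

HB.instance Definition _ (R : realType) (X : metricType R) :=
  gen_eqMixin (boundary X).
HB.instance Definition _ (R : realType) (X : metricType R) :=
  gen_choiceMixin (boundary X).

Variant compactification {R : realType} (X : metricType R) :=
  | Inner of X
  | AtInfinity of boundary X.

HB.instance Definition _ (R : realType) (X : metricType R) :=
  gen_eqMixin (compactification X).
HB.instance Definition _ (R : realType) (X : metricType R) :=
  gen_choiceMixin (compactification X).

Section ConeTopology.
Context {R : realType} {X : metricType R}.

(* g is a geodesic from x to p of length greater than r *)
Definition geodesic_beyond (r : R) (x : X) (p : compactification X)
    (g : R -> X) : Prop :=
  g 0 = x /\
  match p with
  | Inner y => exists l, [/\ r < l, isometric_on `[0, l] g & g l = y]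
  | AtInfinity xi => rays_to xi g
  end.

(* The set U(c, r, eps) of points p at distance greater than r from c 0 whose
   projection to the ball of radius r about c 0 is eps-close to c r. *)
Definition cone_nbhs (c : R -> X) (r eps : R) : set (compactification X) :=
  [set p | exists2 g, geodesic_beyond r (c 0) p g & mdist (g r) (c r) < eps].

(* The cone topology is generated by the balls of X and the sets U(c, r, eps),
   for rays c with arbitrary origin, so that no base point has to be chosen. *)
Definition cone_subbase : set (set (compactification X)) :=
  [set U | (exists (x : X) (r : R), U = @Inner R X @` [set y | mdist x y < r])
        \/ (exists (c : R -> X) (r eps : R),
             [/\ is_ray c, 0 < r, 0 < eps & U = cone_nbhs c r eps])].

HB.instance Definition _ :=
  @isSubBaseTopological.Build (compactification X)
    (set (compactification X)) cone_subbase id.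

End ConeTopology.

HB.instance Definition _ (R : realType) (X : metricType R) :=
  Topological.copy (boundary X) (initial_topology (@AtInfinity R X)).

Section Visual.
Context {R : realType} {X : metricType R}.

(* When X is a proper tree such a g exists, and it is unique because X is dense
   in its compactification. *)
Definition extends_gromov_product (x : X)
    (g : compactification X * compactification X -> \bar R) : Prop :=
  [/\ continuous g,
      forall p, (0 <= g p)%E
    & forall y z, g (Inner y, Inner z) = (gromov_product x y z)%:E].

Definition gromov_product_ext (x : X) :
    compactification X * compactification X -> \bar R :=
  xget (fun=> 0%E) [set g | extends_gromov_product x g].

Definition visual (x : X) (xi eta : boundary X) : R :=
  fine (expeR (- gromov_product_ext x (AtInfinity xi, AtInfinity eta)))%E.

End Visual.

Section Moebius.
Context {R : realType} {Z : topologicalType}.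
Implicit Types rho : Z -> Z -> R.

Definition separating rho : Prop :=
  [/\ continuous (fun p : Z * Z => rho p.1 p.2),
      forall xi eta, 0 <= rho xi eta,
      forall xi eta, rho xi eta = rho eta xi
    & forall xi eta, rho xi eta = 0 <-> xi = eta].

Definition cross_ratio rho (xi xi' eta eta' : Z) : R :=
  (rho xi eta * rho xi' eta') / (rho xi eta' * rho xi' eta).

Definition moebius_equivalent rho1 rho2 : Prop :=
  forall xi xi' eta eta', uniq [:: xi; xi'; eta; eta'] ->
    cross_ratio rho1 xi xi' eta eta' = cross_ratio rho2 xi xi' eta eta'.

Definition antipodal rho : Prop :=
  [/\ separating rho,
      sup [set rho p.1 p.2 | p in [set: Z * Z]] = 1
    & forall xi, exists eta, rho xi eta = 1].

Definition is_derivative rho1 rho2 (f : Z -> R) : Prop :=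
  [/\ continuous f,
      forall xi, 0 < f xi
    & forall xi eta, rho2 xi eta ^+ 2 = f xi * f eta * rho1 xi eta ^+ 2].

(* d rho2 / d rho1: for Moebius equivalent separating functions on a compact Z
   with at least four points, such an f exists and is unique. *)
Definition derivative rho1 rho2 : Z -> R :=
  xget (fun=> 1) [set f | is_derivative rho1 rho2 f].

Definition moebius_space rho0 : set (Z -> Z -> R) :=
  [set rho | antipodal rho /\ moebius_equivalent rho0 rho].

Definition moebius_dist rho1 rho2 : R :=
  sup (range (fun xi => `|ln (derivative rho1 rho2 xi)|)).

End Moebius.

(* Main.v *)
Require Import Defs.
From HB Require Import structures.
From mathcomp Require Import all_boot all_order all_algebra.
From mathcomp Require Import all_classical all_reals all_analysis.
From mathcomp Require Import ring lra.
Import Order.TTheory GRing.Theory Num.Theory.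
Import numFieldNormedType.Exports.
Local Open Scope classical_set_scope.
Local Open Scope ring_scope.
Set Implicit Arguments.
Unset Strict Implicit.
Unset Printing Implicit Defensive.

(** Write rho_x for the visual function of x, and f = d rho / d rho_x for the
    derivative of an antipodal function rho Moebius equivalent to it.

    Distances. Moving the base point from x to y multiplies rho_x ^ 2 by
    exp (b xi) exp (b eta), where b is the Busemann function
    b xi = lim (d(x, z) - d(y, z)) as z tends to xi (visual_change). So b is the
    logarithm of the derivative. It is bounded by d(x, y), with equality at the
    end of a ray from x through y, which exists by geodesic completeness. This
    gives the distance formula, hence injectivity (moebius_dist_visual).

    Surjectivity. Let rho be antipodal and Moebius equivalent to the visual
    functions, and choose xi, eta with rho(xi, eta) = 1. Along the line from eta
    to xi the Busemann function of xi takes all real values, so some z on this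
    line makes the derivative f of rho with respect to rho_z equal to 1 at xi; as
    rho_z(xi, eta) = 1 too, f is also 1 at eta (exists_line_point). Any third
    point zeta branches off the line on one side of z only, so rho_z(zeta, xi) or
    rho_z(zeta, eta) is 1, and rho <= 1 gives f zeta <= 1. Since every zeta has an
    antipode for rho, and rho_z <= 1, in fact f = 1 and rho = rho_z
    (antipodal_eq).

    All this rests on an explicit extension of the Gromov product to the
    compactification. For p in it, trunc x T p is the point at distance T from x
    on the geodesic from x to p (or p, if p is a point of X nearer to x). In a
    tree the Gromov product of trunc x T p and trunc x T q is the minimum of T and
    the product of p and q (trunc_product_min), so the latter is defined as the
    supremum over T. Truncation is continuous for the cone topology, essentially
    by the definition of that topology, hence so is the supremum
    (ext_product_continuous). It is the only continuous extension, because the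
    points of a ray converge to its endpoint (ray_cvg_endpoint), and the values at
    infinity are then limits along rays (gromov_product_ext_infty). *)

(** * Gromov products and betweenness *)

Section GromovProduct.
Context {R : realType} {X : metricType R}.
Implicit Types x y z a b : X.

(** The point y lies on a geodesic from x to z; stated with distances only, so
    that no parametrisation has to be carried along. *)
Definition between x y z := mdist x y + mdist y z = mdist x z.

Lemma gromov_productC x y z : gromov_product x y z = gromov_product x z y.
Proof. by rewrite /gromov_product (metric_sym y z); lra. Qed.

Lemma gromov_product_ge0 x y z : 0 <= gromov_product x y z.
Proof.
rewrite /gromov_product; have := metric_triangle y x z.
by rewrite (metric_sym y x); lra.
Qed.

Lemma gromov_product_lel x y z : gromov_product x y z <= mdist x y.
Proof. by rewrite /gromov_product; have := metric_triangle x y z; lra. Qed.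

Lemma gromov_product_ler x y z : gromov_product x y z <= mdist x z.
Proof. by rewrite gromov_productC gromov_product_lel. Qed.

Lemma gromov_productxx x y : gromov_product x y y = mdist x y.
Proof. by rewrite /gromov_product mdistxx; lra. Qed.

Lemma gromov_product_dist x y z :
  mdist y z = mdist x y + mdist x z - 2 * gromov_product x y z.
Proof. by rewrite /gromov_product; lra. Qed.

(** Turns closeness of truncated points into closeness of their Gromov products
    in the continuity proofs below. *)
Lemma gromov_product_lipschitz x y z y' z' :
  `|gromov_product x y z - gromov_product x y' z'| <= mdist y y' + mdist z z'.
Proof.
rewrite /gromov_product.
have := metric_triangle x y y'; have := metric_triangle x y' y.
have := metric_triangle x z z'; have := metric_triangle x z' z.
have := metric_triangle y y' z; have := metric_triangle y' z' z.
have := metric_triangle y' y z'; have := metric_triangle y z z'.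
rewrite (metric_sym y' y) (metric_sym z' z).
by move=> *; rewrite ler_norml; apply/andP; split; lra.
Qed.

Lemma betweenP x y z : between x y z <-> gromov_product x y z = mdist x y.
Proof. by rewrite /between /gromov_product; split; lra. Qed.

(** In a tree, two geodesics from x run together for the length (y|z)_x and then
    separate for good, so replacing y and z by earlier points of their geodesics
    only caps the product by the distances to those points. Both inequalities
    are instances of 0-hyperbolicity; everything later about trees, rays and
    points at infinity reduces to this formula. *)
Lemma gromov_product_between x a b y z : zero_hyperbolic X ->
  between x a y -> between x b z ->
  gromov_product x a b =
    Num.min (Num.min (mdist x a) (mdist x b)) (gromov_product x y z).
Proof.
move=> hyp /betweenP ay /betweenP bz; apply/le_anti/andP; split.
  rewrite !le_min gromov_product_lel gromov_product_ler /= leNgt.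
  apply/negP => lt_yz_ab.
  have ab_az : gromov_product x a b <= gromov_product x a z.
    by apply: le_trans (hyp x a b z); rewrite le_min lexx bz gromov_product_ler.
  have := hyp x y a z; rewrite leNgt => /negP; apply.
  rewrite lt_min (lt_le_trans lt_yz_ab ab_az) andbT (gromov_productC x y a) ay.
  exact: lt_le_trans (gromov_product_lel x a b).
have yb : Num.min (mdist x b) (gromov_product x y z) <= gromov_product x y b.
  by rewrite minC -bz (gromov_productC x b z); exact: hyp.
rewrite -minA -ay; apply: le_trans (hyp x a y b).
by rewrite le_min ge_min lexx /= ge_min yb orbT.
Qed.

Lemma between_uniq x a b y : zero_hyperbolic X ->
  between x a y -> between x b y -> mdist x a = mdist x b -> a = b.
Proof.
move=> hyp ay bY ab; apply: mdist_positivity.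
rewrite (gromov_product_dist x) (gromov_product_between hyp ay bY).
rewrite gromov_productxx ab minxx.
have xb : mdist x b <= mdist x y by rewrite -bY lerDl mdist_ge0.
by rewrite (min_l xb); lra.
Qed.

End GromovProduct.

(** * Rays and points at infinity *)

Section Rays.
Context {R : realType} {X : metricType R}.
Implicit Types (x y z : X) (c g h : R -> X) (xi eta : boundary X).

Lemma ray_dist c s t : is_ray c -> 0 <= s -> 0 <= t ->
  mdist (c s) (c t) = `|s - t|.
Proof. by move=> cR s0 t0; apply: cR; rewrite /= in_itv /= ?s0 ?t0. Qed.

Lemma ray_dist0 c t : is_ray c -> 0 <= t -> mdist (c 0) (c t) = t.
Proof. by move=> cR t0; rewrite ray_dist// sub0r normrN ger0_norm. Qed.

Lemma ray_between c s t : is_ray c -> 0 <= s -> s <= t ->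
  between (c 0) (c s) (c t).
Proof.
move=> cR s0 st; have t0 := le_trans s0 st.
by rewrite /between !ray_dist0// ray_dist// distrC ger0_norm ?subr_ge0//; lra.
Qed.

Lemma asymptotic_refl c : asymptotic c c.
Proof. by exists 0 => t _; rewrite mdistxx. Qed.

Lemma asymptotic_sym c g : asymptotic c g -> asymptotic g c.
Proof. by case=> K H; exists K => t t0; rewrite metric_sym H. Qed.

Lemma asymptotic_trans g c h : asymptotic c g -> asymptotic g h -> asymptotic c h.
Proof.
case=> K H [L H']; exists (K + L) => t t0.
by rewrite (le_trans (metric_triangle _ (g t) _))// lerD ?H ?H'.
Qed.

Lemma rays_to_ray xi c : rays_to xi c -> is_ray c.
Proof. by have [g gR ->] := rays_to_class xi; case. Qed.

Lemma rays_to_asymptotic xi c g :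
  rays_to xi c -> rays_to xi g -> asymptotic c g.
Proof.
have [h hR ->] := rays_to_class xi => -[_ hc] [_ hg].
exact: asymptotic_trans (asymptotic_sym hc) hg.
Qed.

Lemma rays_to_closed xi c g :
  rays_to xi c -> is_ray g -> asymptotic c g -> rays_to xi g.
Proof.
have [h hR ->] := rays_to_class xi => -[_ hc] gR cg; split=> //.
exact: asymptotic_trans hc cg.
Qed.

Lemma exists_rays_to xi : exists c, rays_to xi c.
Proof.
by have [g gR ->] := rays_to_class xi; exists g; split=> //; exact: asymptotic_refl.
Qed.

Lemma exists_endpoint c : is_ray c -> exists xi, rays_to xi c.
Proof.
move=> cR; have H : exists2 h, is_ray h &
  [set g | is_ray g /\ asymptotic c g] = [set g | is_ray g /\ asymptotic h g].
  by exists c.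
by exists (Boundary H); split=> //; exact: asymptotic_refl.
Qed.

(** A class consists of all rays asymptotic to any one of its members, so a common
    ray forces equal classes; the existence proofs stored in boundary points are
    irrelevant. *)
Lemma rays_to_inj xi eta c : rays_to xi c -> rays_to eta c -> xi = eta.
Proof.
move=> xic etac; have E : rays_to xi = rays_to eta.
  apply/funext => g; apply/propext; split => H.
    apply: (rays_to_closed etac (rays_to_ray H)); exact: rays_to_asymptotic H.
  apply: (rays_to_closed xic (rays_to_ray H)); exact: rays_to_asymptotic H.
move: E {xic etac}; case: xi => A HA; case: eta => B HB /= E; subst B.
by congr Boundary; exact: Prop_irrelevance.
Qed.

(** The product of c T and g T differs from T by at most half the bound on the
    distance between the rays, so for T large it exceeds t and the two rays have
    not yet separated at time t. *)
Lemma rays_agree c g : zero_hyperbolic X -> is_ray c -> is_ray g ->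
  asymptotic c g -> c 0 = g 0 -> forall t, 0 <= t -> c t = g t.
Proof.
move=> hyp cR gR [K cgK] cg0 t t0.
have K0 : 0 <= K by rewrite (le_trans (mdist_ge0 (c 0) (g 0))) ?cgK.
apply: mdist_positivity; rewrite (gromov_product_dist (c 0)).
have tK : t <= t + K by lra.
have := ray_between gR t0 tK; rewrite -cg0.
move=> /(gromov_product_between hyp (ray_between cR t0 tK)) ->.
have tK0 : 0 <= t + K by lra.
have := cgK _ tK0; rewrite (gromov_product_dist (c 0)) cg0 !ray_dist0//.
rewrite -cg0 !ray_dist0// minxx => le_K.
by rewrite min_l; lra.
Qed.

End Rays.

(** * Truncation of geodesics at a given length *)

Section Truncation.
Context {R : realType} {X : metricType R}.
Context (X_tree : metric_tree X).
Implicit Types (x y z : X) (c g h : R -> X) (xi eta : boundary X).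
Implicit Types (p q : compactification X) (S T : R).

Let hyp : zero_hyperbolic X := X_tree.2.

(** z is the point at distance T from x on the geodesic from x to p, or p itself
    when p is a point of X closer than T. *)
Definition is_trunc x T p z : Prop :=
  match p with
  | Inner y => between x z y /\ mdist x z = Num.min T (mdist x y)
  | AtInfinity xi => exists g, [/\ g 0 = x, rays_to xi g & g T = z]
  end.

Definition trunc x T p : X := xget x [set z | is_trunc x T p z].

Lemma is_trunc_uniq x T p z z' : 0 <= T ->
  is_trunc x T p z -> is_trunc x T p z' -> z = z'.
Proof.
case: p => [y|xi] T0 /=.
  by move=> [zy dz] [zy' dz']; apply: (between_uniq hyp zy zy'); rewrite dz.
move=> [g [g0 xig <-]] [h [h0 xih <-]].
apply: rays_agree => //; [exact: rays_to_ray xig|exact: rays_to_ray xih| |].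
  exact: rays_to_asymptotic xig xih.
by rewrite g0 h0.
Qed.

Lemma trunc_eq x T p z : 0 <= T -> is_trunc x T p z -> trunc x T p = z.
Proof.
move=> T0 zP; apply: (is_trunc_uniq T0 _ zP).
exact: (xgetPex x (ex_intro _ z zP)).
Qed.

(** Connects truncations with the parametrised geodesics that define the cone
    topology. *)
Lemma is_trunc_geodesic x y c T l : 0 <= T -> T <= l ->
  isometric_on `[0, l] c -> c 0 = x -> c l = y -> is_trunc x T (Inner y) (c T).
Proof.
move=> T0 Tl cI <- <-; have l0 := le_trans T0 Tl.
have D s t : 0 <= s -> s <= t -> t <= l -> mdist (c s) (c t) = t - s.
  move=> s0 st tl; rewrite cI /= ?in_itv /= ?s0 ?tl ?(le_trans s0 st)//.
    by rewrite distrC ger0_norm// subr_ge0.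
  by rewrite (le_trans st).
by split; rewrite /between !D ?lexx ?subr0 ?(min_l Tl)//; lra.
Qed.

Lemma truncP_inner x T y : 0 <= T -> is_trunc x T (Inner y) (trunc x T (Inner y)).
Proof.
move=> T0; suff [z zP] : exists z, is_trunc x T (Inner y) z.
  by rewrite (trunc_eq T0 zP).
have [c [cI c0 cl]] := X_tree.1 x y.
have [Tl|/ltW lT] := leP T (mdist x y).
  by exists (c T); apply: is_trunc_geodesic cI c0 cl.
by exists y; split; rewrite /between ?mdistxx ?addr0// min_r.
Qed.

Lemma trunc_inner_between x T y : 0 <= T -> between x (trunc x T (Inner y)) y.
Proof. by move=> /(truncP_inner x y)[]. Qed.

Lemma mdist_trunc_inner x T y : 0 <= T ->
  mdist x (trunc x T (Inner y)) = Num.min T (mdist x y).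
Proof. by move=> /(truncP_inner x y)[]. Qed.

Lemma trunc_inner_id x T y : mdist x y <= T -> trunc x T (Inner y) = y.
Proof.
move=> yT; apply: trunc_eq; first exact: le_trans (mdist_ge0 x y) yT.
by split; rewrite /between ?mdistxx ?addr0// min_r.
Qed.

(** The geodesics from x to the points of a ray c towards xi agree on longer and
    longer initial segments, since the product of c a and c b seen from x is at
    least min a b - d(x, c 0). Their union is the required ray. *)
Lemma exists_ray_from x xi : exists2 g, g 0 = x & rays_to xi g.
Proof.
have [c xic] := exists_rays_to xi; have cR := rays_to_ray xic.
pose D := mdist x (c 0); have D0 : 0 <= D by exact: mdist_ge0.
have far a : 0 <= a -> a - D <= mdist x (c a) <= a + D.
  move=> a0; have := metric_triangle x (c 0) (c a).
  have := metric_triangle (c 0) x (c a).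
  by rewrite (ray_dist0 cR a0) (metric_sym (c 0) x) -/D; lra.
(* c (t + D) is at distance at least t from x *)
pose g t := trunc x t (Inner (c (t + D))).
have g_btw t : 0 <= t -> between x (g t) (c (t + D)).
  exact: trunc_inner_between.
have dg t : 0 <= t -> mdist x (g t) = t.
  move=> t0; rewrite mdist_trunc_inner// min_l//.
  by have := far (t + D); lra.
have gI s t : 0 <= s -> s <= t -> mdist (g s) (g t) = t - s.
  move=> s0 st; have t0 := le_trans s0 st.
  rewrite (gromov_product_dist x) !dg//.
  rewrite (gromov_product_between hyp (g_btw _ s0) (g_btw _ t0)) !dg//.
  rewrite (min_l st) min_l; first by lra.
  rewrite /gromov_product (ray_dist cR); try lra.
  have -> : s + D - (t + D) = - (t - s) by lra.
  rewrite normrN ger0_norm ?subr_ge0//.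
  by have := far (s + D); have := far (t + D); lra.
have gR : is_ray g.
  move=> s t /=; rewrite !in_itv /= !andbT => s0 t0.
  have [st|/ltW ts] := leP s t.
    by rewrite gI// distrC ger0_norm// subr_ge0.
  by rewrite metric_sym gI// ger0_norm// subr_ge0.
exists g; first by rewrite /g; apply/esym/mdist_positivity; rewrite dg.
apply: rays_to_closed xic gR _; exists (3 * D) => t t0.
apply: le_trans (metric_triangle _ (c (t + D)) _) _.
have := g_btw _ t0; rewrite /between dg// => E.
rewrite (metric_sym _ (g t)) (ray_dist cR)//; last by lra.
have -> : t - (t + D) = - D by lra.
by rewrite normrN ger0_norm//; have := far (t + D); lra.
Qed.

Lemma trunc_ray x xi : exists g,
  [/\ g 0 = x, rays_to xi g &
      forall T, 0 <= T -> trunc x T (AtInfinity xi) = g T].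
Proof.
have [g g0 xig] := exists_ray_from x xi; exists g; split=> // T T0.
by apply: trunc_eq => //; exists g.
Qed.

Lemma mdist_trunc_infty x T xi : 0 <= T -> mdist x (trunc x T (AtInfinity xi)) = T.
Proof.
move=> T0; have [g [<- xig ->//]] := trunc_ray x xi.
by rewrite ray_dist0//; exact: rays_to_ray xig.
Qed.

Lemma mdist_trunc_le x T p : 0 <= T -> mdist x (trunc x T p) <= T.
Proof.
case: p => [y|xi] T0; last by rewrite mdist_trunc_infty.
by rewrite mdist_trunc_inner// ge_min lexx.
Qed.

Lemma mdist_trunc_min x S T p : 0 <= S -> S <= T ->
  mdist x (trunc x S p) = Num.min S (mdist x (trunc x T p)).
Proof.
move=> S0 ST; have T0 := le_trans S0 ST.
case: p => [y|xi]; last by rewrite !mdist_trunc_infty// min_l.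
by rewrite !mdist_trunc_inner// minA (min_l ST).
Qed.

Lemma trunc_between x S T p : 0 <= S -> S <= T ->
  between x (trunc x S p) (trunc x T p).
Proof.
move=> S0 ST; have T0 := le_trans S0 ST.
case: p => [y|xi]; last first.
  have [g [<- xig gE]] := trunc_ray x xi; rewrite !gE//.
  by apply: ray_between => //; exact: rays_to_ray xig.
apply/betweenP; have Sy := trunc_inner_between x y S0.
have Ty := trunc_inner_between x y T0.
rewrite (gromov_product_between hyp Sy Ty) gromov_productxx !mdist_trunc_inner//.
have Sd : Num.min S (mdist x y) <= Num.min T (mdist x y).
  by rewrite le_min !ge_min ST lexx orbT.
by rewrite (min_l Sd) min_l// ge_min lexx orbT.
Qed.

(** The minimum of T and the Gromov product of p and q. *)
Definition trunc_product x T p q : R :=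
  gromov_product x (trunc x T p) (trunc x T q).

Lemma trunc_productC x T p q : trunc_product x T p q = trunc_product x T q p.
Proof. exact: gromov_productC. Qed.

Lemma trunc_product_ge0 x T p q : 0 <= trunc_product x T p q.
Proof. exact: gromov_product_ge0. Qed.

Lemma trunc_product_le x T p q : 0 <= T -> trunc_product x T p q <= T.
Proof.
by move=> T0; apply: le_trans (gromov_product_lel _ _ _) _; exact: mdist_trunc_le.
Qed.

Lemma trunc_product_infty x T xi : 0 <= T ->
  trunc_product x T (AtInfinity xi) (AtInfinity xi) = T.
Proof. by move=> T0; rewrite /trunc_product gromov_productxx mdist_trunc_infty. Qed.

Lemma trunc_product_inner x T y z : mdist x y <= T -> mdist x z <= T ->
  trunc_product x T (Inner y) (Inner z) = gromov_product x y z.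
Proof. by move=> yT zT; rewrite /trunc_product !trunc_inner_id. Qed.

(** Truncating at a smaller scale caps the product, so these products form a
    coherent family whose supremum is the product of p and q. *)
Lemma trunc_product_min x S T p q : 0 <= S -> S <= T ->
  trunc_product x S p q = Num.min S (trunc_product x T p q).
Proof.
move=> S0 ST; rewrite /trunc_product.
rewrite (gromov_product_between hyp (trunc_between x p S0 ST) (trunc_between x q S0 ST)).
rewrite !(mdist_trunc_min x _ S0 ST).
set a := gromov_product _ _ _.
have ap : a <= mdist x (trunc x T p) by exact: gromov_product_lel.
have aq : a <= mdist x (trunc x T q) by exact: gromov_product_ler.
by rewrite -minA -(minA S (mdist _ _) a) (min_r aq) minCA -minA (min_r ap) minA minxx.
Qed.

Lemma trunc_product_trunc x S T p q : 0 <= S -> S <= T ->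
  trunc_product x T (Inner (trunc x S p)) q = trunc_product x S p q.
Proof.
move=> S0 ST; have T0 := le_trans S0 ST.
rewrite (trunc_product_min x p q S0 ST) /trunc_product.
rewrite trunc_inner_id; last exact: le_trans (mdist_trunc_le x p S0) ST.
have T_btw : between x (trunc x T q) (trunc x T q).
  by rewrite /between mdistxx addr0.
rewrite (gromov_product_between hyp (trunc_between x p S0 ST) T_btw).
rewrite (mdist_trunc_min x _ S0 ST); set a := gromov_product _ _ _.
have ap : a <= mdist x (trunc x T p) by exact: gromov_product_lel.
have aq : a <= mdist x (trunc x T q) by exact: gromov_product_ler.
by rewrite -minA (min_r aq) -minA (min_r ap).
Qed.

(** The nearest-point projection of a tree onto a ball does not increase
    distances. *)
Lemma trunc_inner_lipschitz x T y z : 0 <= T ->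
  mdist (trunc x T (Inner y)) (trunc x T (Inner z)) <= mdist y z.
Proof.
move=> T0.
have yT := trunc_inner_between x y T0; have zT := trunc_inner_between x z T0.
rewrite (gromov_product_dist x (trunc x T _)).
rewrite (gromov_product_between hyp yT zT) !mdist_trunc_inner//.
rewrite (gromov_product_dist x y z).
have := gromov_product_lel x y z; have := gromov_product_ler x y z.
have := mdist_ge0 y z; rewrite (gromov_product_dist x y z).
move: (gromov_product x y z) (mdist x y) (mdist x z) => a b c yz ac ab.
have [Tb|bT] := leP T b; have [Tc|cT] := leP T c.
- by rewrite minxx; have [?|?] := leP T a; lra.
- by rewrite (min_r (ltW cT)); have [?|?] := leP c a; lra.
- by rewrite (min_l (ltW bT)); have [?|?] := leP b a; lra.
by rewrite (@min_r _ _ _ a) ?le_min ?ab.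
Qed.

End Truncation.

(** * The Gromov product on the compactification *)

Section ExtendedProduct.
Context {R : realType} {X : metricType R} (X_tree : metric_tree X).
Implicit Types (x y z : X) (c g h : R -> X) (xi eta : boundary X).
Implicit Types (p q : compactification X) (S T : R).

Let hyp : zero_hyperbolic X := X_tree.2.

(** The truncated products increase with T, so this is their limit. *)
Definition ext_product x (pq : compactification X * compactification X) : \bar R :=
  ereal_sup [set (trunc_product x T pq.1 pq.2)%:E | T in [set T | 0 <= T]].

Lemma le_ext_product x T p q : 0 <= T ->
  ((trunc_product x T p q)%:E <= ext_product x (p, q))%E.
Proof. by move=> T0; apply: ereal_sup_ubound; exists T. Qed.

Lemma ext_product_ge0 x pq : (0 <= ext_product x pq)%E.
Proof.
case: pq => p q; apply: le_trans (le_ext_product x p q (lexx 0)).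
by rewrite lee_fin trunc_product_ge0.
Qed.

Lemma ext_productC x p q : ext_product x (p, q) = ext_product x (q, p).
Proof. by congr ereal_sup; apply/eq_imagel => T _ /=; rewrite trunc_productC. Qed.

(** If the geodesics to p and q have separated before time T, later times do not
    change the product. Hence the extended product is locally a truncated
    product wherever it is finite. *)
Lemma ext_product_fin x T p q : 0 <= T -> trunc_product x T p q < T ->
  ext_product x (p, q) = (trunc_product x T p q)%:E.
Proof.
move=> T0 pqT; apply/le_anti/andP; split; last exact: le_ext_product.
apply: ge_ereal_sup => _ [S S0 <-]; rewrite lee_fin.
have [ST|TS] := leP S T.
  by rewrite (trunc_product_min X_tree x p q S0 ST) ge_min lexx orbT.
move: pqT; rewrite (trunc_product_min X_tree x p q T0 (ltW TS)).
by rewrite gt_min ltxx /= => tT; rewrite (min_r (ltW tT)).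
Qed.

Lemma ext_product_infty x p q :
  (forall T, 0 <= T -> T <= trunc_product x T p q) -> ext_product x (p, q) = +oo%E.
Proof.
move=> H; apply/eqyP => r r0; apply: le_trans (le_ext_product x p q (ltW r0)).
by rewrite lee_fin H// ltW.
Qed.

Lemma ext_product_inner x y z :
  ext_product x (Inner y, Inner z) = (gromov_product x y z)%:E.
Proof.
pose T := mdist x y + mdist x z + 1.
have yz : trunc_product x T (Inner y) (Inner z) = gromov_product x y z.
  apply: trunc_product_inner => //; rewrite /T;
  by have := mdist_ge0 x y; have := mdist_ge0 x z; lra.
have := mdist_ge0 x y; have := mdist_ge0 x z; have := gromov_product_lel x y z.
by move=> *; rewrite (@ext_product_fin x T) ?yz// /T; lra.
Qed.

Lemma ext_product_trunc x S p q : 0 <= S ->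
  ext_product x (Inner (trunc x S p), q) = (trunc_product x S p q)%:E.
Proof.
move=> S0; have SS : S <= S + 1 by lra.
have E := trunc_product_trunc X_tree x p q S0 SS.
have le_S : trunc_product x S p q <= S by exact: trunc_product_le.
by rewrite (@ext_product_fin x (S + 1)) ?E//; lra.
Qed.

Lemma ext_product_inner_fin x y q : ext_product x (Inner y, q) \is a fin_num.
Proof.
rewrite -(trunc_inner_id X_tree (lexx (mdist x y))) ext_product_trunc//.
exact: mdist_ge0.
Qed.

Lemma ext_product_diag x xi :
  ext_product x (AtInfinity xi, AtInfinity xi) = +oo%E.
Proof. by apply: ext_product_infty => T T0; rewrite trunc_product_infty. Qed.

(** Otherwise the rays from x to xi and eta never separate, and are equal. *)
Lemma trunc_product_lt x xi eta : xi <> eta ->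
  exists2 T, 0 <= T & trunc_product x T (AtInfinity xi) (AtInfinity eta) < T.
Proof.
move=> neq; apply/not_exists2P => H; apply: neq.
have [g [g0 xig gE]] := trunc_ray X_tree x xi.
have [h [h0 etah hE]] := trunc_ray X_tree x eta.
have gR := rays_to_ray xig; have hR := rays_to_ray etah.
apply: rays_to_inj xig _; apply: (rays_to_closed etah gR).
exists 0 => T T0; rewrite -gE// -hE// (gromov_product_dist x).
rewrite !mdist_trunc_infty//.
have [//|/negP] := H T; rewrite -leNgt /trunc_product gromov_productC.
by have := mdist_ge0 (trunc x T (AtInfinity xi)) (trunc x T (AtInfinity eta)); lra.
Qed.

Lemma open_subbase (U : set (compactification X)) : cone_subbase U -> open U.
Proof.
move=> HU; exists [set U]; last by rewrite bigcup_set1.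
by move=> _ ->; exact: (finI_from1 id HU).
Qed.

(** Convergence in the cone topology needs to be tested on the generating sets
    only. *)
Lemma cvg_subbase (F : set_system (compactification X)) p : Filter F ->
  (forall U, cone_subbase U -> U p -> F U) -> F --> p.
Proof.
move=> FF H A; rewrite nbhsE => -[B [oB Bp] BA]; apply: filterS BA _.
case: oB Bp => D DS <- [U DU Up]; apply: filterS (bigcup_sup DU) _.
have [E ES EU] := DS _ DU; rewrite -EU; apply: filter_bigI => V VE.
by apply: H; [exact: set_mem (ES _ VE)|move: Up; rewrite -EU; exact].
Qed.

End ExtendedProduct.

(** * Continuity and uniqueness of the extension *)

Section Extension.
Context {R : realType} {X : metricType R} (X_tree : metric_tree X).
Implicit Types (x y z : X) (c g h : R -> X) (xi eta : boundary X).
Implicit Types (p q : compactification X) (S T : R).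

Let hyp : zero_hyperbolic X := X_tree.2.

(** Truncation is continuous for the cone topology: at a point xi at infinity, if
    c is the ray from x to xi, the points of U(c, T, e) have their truncation at T
    within e of that of xi. *)
Lemma near_trunc x T p e : 0 <= T -> 0 < e ->
  \forall q \near p, mdist (trunc x T p) (trunc x T q) < e.
Proof.
move=> T0 e0; case: p => [y|xi].
  have oB : open (@Inner R X @` [set z | mdist y z < e]).
    by apply: open_subbase; left; exists y, e.
  apply: filterS (open_nbhs_nbhs (conj oB _)).
    by move=> _ [z /= yz <-]; apply: le_lt_trans yz; exact: trunc_inner_lipschitz.
  by exists y => //=; rewrite mdistxx.
have [->|T_neq0] := eqVneq T 0.
  apply: filterE => q; suff E p : trunc x 0 p = x by rewrite !E mdistxx.
  apply/esym/mdist_positivity/le_anti.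
  by rewrite mdist_ge0 mdist_trunc_le.
have {T_neq0}T_gt0 : 0 < T by rewrite lt_def T_neq0.
have [g [g0 xig gE]] := trunc_ray X_tree x xi.
have oB : open (cone_nbhs g T e).
  apply: open_subbase; right; exists g, T, e; split=> //; exact: rays_to_ray xig.
apply: filterS (open_nbhs_nbhs (conj oB _)); last first.
  by exists g => //; rewrite mdistxx.
move=> q [h [h0 hq] hg]; rewrite gE// metric_sym.
suff -> : trunc x T q = h T by [].
apply: trunc_eq => //; case: q hq => [y [l [/ltW Tl hI hl]]|eta etah].
  by apply: is_trunc_geodesic hI _ hl => //; rewrite h0.
by exists h; split; rewrite ?h0.
Qed.

Lemma near_trunc_product x T p q e : 0 <= T -> 0 < e ->
  \forall pq \near (p, q),
    `|trunc_product x T p q - trunc_product x T pq.1 pq.2| < e.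
Proof.
move=> T0 e0; have e2 : 0 < e / 2 by rewrite divr_gt0.
exists ([set p' | mdist (trunc x T p) (trunc x T p') < e / 2],
        [set q' | mdist (trunc x T q) (trunc x T q') < e / 2]).
  by split; exact: near_trunc.
move=> [p' q'] [/= pp' qq'].
by apply: le_lt_trans (gromov_product_lipschitz _ _ _ _ _) _; lra.
Qed.

(** Where the product is finite it coincides nearby with a truncated product;
    where it is infinite the truncated products, being equal to their scale T,
    bound it below nearby by T - 1. *)
Lemma ext_product_continuous x : continuous (ext_product x).
Proof.
move=> [p q]; rewrite /continuous_at.
have [[T [T0 pqT]]|] := pselect (exists T, 0 <= T /\ trunc_product x T p q < T).
  have Tpq : 0 < T - trunc_product x T p q by rewrite subr_gt0.
  have near_T : \forall pq \near (p, q), trunc_product x T pq.1 pq.2 < T.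
    apply: filterS (near_trunc_product x p q T0 Tpq) => -[p' q'] /=.
    by rewrite ltr_norml => /andP[+ _]; lra.
  rewrite (ext_product_fin X_tree T0 pqT); apply: cvg_EFin.
    by apply: filterS near_T => -[p' q'] /= H; rewrite (ext_product_fin X_tree T0 H).
  apply/cvgrPdist_lt => e e0.
  apply: filterS2 near_T (near_trunc_product x p q T0 e0) => -[p' q'] /= H.
  by rewrite (ext_product_fin X_tree T0 H).
move=> H; rewrite (@ext_product_infty _ _ x p q); last first.
  by move=> T T0; rewrite leNgt; apply/negP => pqT; apply: H; exists T.
apply/cvgeyPge => A; pose T := Num.max A 0 + 1.
have T0 : 0 <= T by rewrite addr_ge0// le_max lexx orbT.
apply: filterS (near_trunc_product x p q T0 ltr01) => -[p' q'] /= pq1.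
apply: le_trans (le_ext_product x p' q' T0); rewrite lee_fin.
have TE : T <= trunc_product x T p q.
  by rewrite leNgt; apply/negP => pqT; apply: H; exists T.
have AT : A <= T - 1 by rewrite addrK le_max lexx.
by move: pq1; rewrite ltr_norml => /andP[_]; lra.
Qed.

Lemma ext_product_extends x : extends_gromov_product x (ext_product x).
Proof.
split; first exact: ext_product_continuous.
  exact: ext_product_ge0.
exact: ext_product_inner.
Qed.

(** The base point of a set U(b, r, e) is unrelated to the origin of c, so the
    geodesic from b 0 to c t is compared with the ray g from b 0 to xi: they
    agree up to time r as soon as the product of c t and g t exceeds r. *)
Lemma ray_cvg_endpoint xi c : rays_to xi c ->
  Inner (c t) @[t --> +oo] --> AtInfinity xi.
Proof.
move=> xic; have cR := rays_to_ray xic; apply: cvg_subbase.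
move=> U [[x [r ->]] [y _ //]|[b [r [e [bR r0 e0 ->]]]]].
move=> [g [g0 xig] gb]; have gR := rays_to_ray xig.
have [K cgK] := rays_to_asymptotic xic xig.
set y := b 0 in g0; pose D := mdist y (c 0).
have D0 : 0 <= D by exact: mdist_ge0.
have K0 : 0 <= K by apply: le_trans (cgK 0 (lexx 0)); exact: mdist_ge0.
change (\forall t \near +oo, cone_nbhs b r e (Inner (c t))); near=> t.
(* so that d(y, c t) > r and the product of c t and g t is at least r *)
have tr : r + D + 2 * r + D + K < t.
  by near: t; apply: nbhs_pinfty_gt; exact: num_real.
have t0 : 0 <= t by lra.
have [h [hI h0 hl]] := X_tree.1 y (c t).
have yct : t - D <= mdist y (c t).
  have := metric_triangle (c 0) y (c t).
  by rewrite (ray_dist0 cR t0) (metric_sym _ y) -/D; lra.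
have rl : r < mdist y (c t) by lra.
exists h; first by split=> //; exists (mdist y (c t)).
suff -> : h r = g r by [].
have hr := is_trunc_geodesic (ltW r0) (ltW rl) hI h0 hl.
have [hb hd] := hr; have rt : r <= t by lra.
have gb' := ray_between gR (ltW r0) rt; rewrite g0 in gb'.
have gr : mdist y (g r) = r by rewrite -g0 ray_dist0// ltW.
have gt : mdist y (g t) = t by rewrite -g0 ray_dist0.
apply: mdist_positivity; rewrite (gromov_product_dist y).
rewrite (gromov_product_between hyp hb gb') gr hd (min_l (ltW rl)) minxx.
rewrite min_l; first by lra.
by rewrite /gromov_product gt; have := cgK t t0; lra.
Unshelve. all: by end_near. Qed.

Lemma ray_cvg_extension x xi eta c g f : extends_gromov_product x f ->
  rays_to xi c -> rays_to eta g ->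
  (gromov_product x (c t) (g t))%:E @[t --> +oo] -->
    f (AtInfinity xi, AtInfinity eta).
Proof.
move=> [fC _ fI] xic etag; under eq_fun do rewrite -fI.
apply: (@continuous_cvg _ _ _ _ _ (fun t => (Inner (c t), Inner (g t))) f).
  exact: fC.
exact: (cvg_pair (ray_cvg_endpoint xic) (ray_cvg_endpoint etag)).
Qed.

(** Both extensions are limits of the same products of points of X along rays,
    and limits in the extended reals are unique. *)
Lemma gromov_product_ext_infty x xi eta :
  gromov_product_ext x (AtInfinity xi, AtInfinity eta) =
  ext_product x (AtInfinity xi, AtInfinity eta).
Proof.
have ext := ext_product_extends x.
have ext' : extends_gromov_product x (gromov_product_ext x).
  exact: (xgetPex _ (ex_intro _ _ ext)).
have [c xic] := exists_rays_to xi; have [g etag] := exists_rays_to eta.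
have H := ray_cvg_extension ext xic etag.
have H' := ray_cvg_extension ext' xic etag.
exact: (cvg_unique (@ereal_hausdorff R) H' H).
Qed.

(** The real value of the product for xi <> eta; on the diagonal, where the product
    is +oo, the value is 0. *)
Definition infty_product x xi eta : R :=
  fine (ext_product x (AtInfinity xi, AtInfinity eta)).

(** The Busemann function: how much closer y is to xi than x. The formula comes
    from d(x, z) - d(y, z) = 2 (y|z)_x - d(x, y), which makes sense for z at
    infinity. *)
Definition busemann x y xi : R :=
  2 * fine (ext_product x (Inner y, AtInfinity xi)) - mdist x y.

Lemma ext_product_fin_num x xi eta : xi <> eta ->
  ext_product x (AtInfinity xi, AtInfinity eta) \is a fin_num.
Proof.
by move=> /(trunc_product_lt X_tree x)[T T0 H]; rewrite (ext_product_fin X_tree T0 H).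
Qed.

Lemma ray_cvg_product x xi eta c g : xi <> eta ->
  rays_to xi c -> rays_to eta g ->
  gromov_product x (c t) (g t) @[t --> +oo] --> infty_product x xi eta.
Proof.
move=> neq xic etag;
apply: (@fine_cvg _ _ _ _ (fun t => (gromov_product x (c t) (g t))%:E)).
rewrite /infty_product fineK ?ext_product_fin_num//.
exact: ray_cvg_extension (ext_product_extends x) xic etag.
Qed.

Lemma ray_cvg_busemann x y xi c : rays_to xi c ->
  mdist x (c t) - mdist y (c t) @[t --> +oo] --> busemann x y xi.
Proof.
move=> xic.
have -> : (fun t => mdist x (c t) - mdist y (c t)) =
    (fun t => 2 * gromov_product x y (c t) - mdist x y).
  by apply/funext => t; rewrite /gromov_product; lra.
apply: cvgB; last exact: cvg_cst.
apply: cvgM; first exact: cvg_cst.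
apply: (@fine_cvg _ _ _ _ (fun t => (gromov_product x y (c t))%:E)).
rewrite fineK ?ext_product_inner_fin//.
under eq_fun do rewrite -ext_product_inner//.
apply: (@continuous_cvg _ _ _ _ _ (fun t => (Inner y, Inner (c t))) (ext_product x)).
  exact: ext_product_continuous.
exact: (cvg_pair (cvg_cst _) (ray_cvg_endpoint xic)).
Qed.

(** The corresponding identity in X is linear in the distances, and passes to the
    limit along rays. *)
Lemma infty_product_change x y xi eta : xi <> eta ->
  2 * infty_product y xi eta =
  2 * infty_product x xi eta - busemann x y xi - busemann x y eta.
Proof.
move=> neq.
have [c xic] := exists_rays_to xi; have [g etag] := exists_rays_to eta.
have H : 2 * gromov_product y (c t) (g t) @[t --> +oo] --> 2 * infty_product y xi eta.
  by apply: cvgM; [exact: cvg_cst|exact: ray_cvg_product].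
apply: (cvg_unique (@Rhausdorff R) H).
have -> : (fun t => 2 * gromov_product y (c t) (g t)) =
    (fun t => 2 * gromov_product x (c t) (g t)
      - (mdist x (c t) - mdist y (c t)) - (mdist x (g t) - mdist y (g t))).
  by apply/funext => t; rewrite /gromov_product; lra.
apply: cvgB; last exact: ray_cvg_busemann.
apply: cvgB; last exact: ray_cvg_busemann.
by apply: cvgM; [exact: cvg_cst|exact: ray_cvg_product].
Qed.

End Extension.

(** * The visual functions *)

(** Carries continuity from the products to the visual functions: exp (- l) is
    real and continuous for l in [0, +oo], with value 0 at +oo. *)
Lemma cvg_expeRN {R : realType} {I : Type} (F : set_system I) (FF : Filter F)
    (f : I -> \bar R) (l : \bar R) : (0 <= l)%E -> f @ F --> l ->
  fine (expeR (- f i))%E @[i --> F] --> fine (expeR (- l))%E.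
Proof.
case: l => [r _ fr|_ fy|//] /=.
  have fN := cvg_is_fine fr.
  have H : expR (- fine (f i)) @[i --> F] --> expR (- r).
    apply: (@continuous_cvg _ _ _ _ _ (fun i => - fine (f i)) expR).
      exact: continuous_expR.
    exact: cvgN (fine_cvg fr).
  apply: cvg_trans H; apply: near_eq_cvg.
  by apply: filterS fN => i; case: (f i).
apply/cvgrPdist_lt => e e0; move/cvgeyPgt : fy => /(_ (- ln e)).
apply: filterS => i; rewrite sub0r normrN.
case: (f i) => [r| |]//=; last by rewrite normr0.
rewrite lte_fin ger0_norm ?expR_ge0// => H.
by rewrite -[ltRHS]lnK ?posrE// ltr_expR ltrNl.
Qed.

Section Visual.
Context {R : realType} {X : metricType R} (X_tree : metric_tree X).
Implicit Types (x y z : X) (c g h : R -> X) (xi eta zeta : boundary X).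
Implicit Types (p q : compactification X) (S T : R).

Lemma AtInfinity_continuous : continuous (@AtInfinity R X).
Proof. exact: (@initial_continuous (boundary X) (compactification X)). Qed.

Lemma visualE x xi eta : visual x xi eta =
  fine (expeR (- ext_product x (AtInfinity xi, AtInfinity eta)))%E.
Proof. by rewrite /visual gromov_product_ext_infty. Qed.

Lemma visual_diag x xi : visual x xi xi = 0.
Proof. by rewrite visualE ext_product_diag. Qed.

Lemma visual_neq x xi eta : xi <> eta ->
  visual x xi eta = expR (- infty_product x xi eta).
Proof.
by move=> /(ext_product_fin_num X_tree x) H; rewrite visualE -(fineK H).
Qed.

Lemma visual_ge0 x xi eta : 0 <= visual x xi eta.
Proof. by rewrite visualE fine_ge0// expeR_ge0. Qed.

Lemma visualC x xi eta : visual x xi eta = visual x eta xi.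
Proof. by rewrite !visualE ext_productC. Qed.

Lemma visual_gt0 x xi eta : xi <> eta -> 0 < visual x xi eta.
Proof. by move=> H; rewrite visual_neq// expR_gt0. Qed.

Lemma infty_product_ge0 x xi eta : 0 <= infty_product x xi eta.
Proof. by rewrite fine_ge0// ext_product_ge0. Qed.

Lemma visual_le1 x xi eta : visual x xi eta <= 1.
Proof.
have [->|/eqP neq] := eqVneq xi eta; first by rewrite visual_diag.
by rewrite visual_neq// -expR0 ler_expR oppr_le0 infty_product_ge0.
Qed.

(** Both sides say that x lies on the line from xi to eta. Testing at one
    positive scale is enough, as the product vanishes iff its cap does. *)
Lemma visual_eq1 x T xi eta : 0 < T -> visual x xi eta = 1 <->
  trunc_product x T (AtInfinity xi) (AtInfinity eta) = 0.
Proof.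
move=> T0; split=> [v1|t0]; last first.
  rewrite visualE (@ext_product_fin _ _ X_tree x T) ?t0// ?ltW//=.
  by rewrite oppr0 expR0.
have neq : xi <> eta.
  by move=> E; move: v1; rewrite E visual_diag => /esym/eqP; rewrite oner_eq0.
have := le_ext_product x (AtInfinity xi) (AtInfinity eta) (ltW T0).
rewrite -(fineK (ext_product_fin_num X_tree x neq)) lee_fin -/(infty_product _ _ _).
move: v1; rewrite visual_neq// -expR0 => /expR_inj/eqP; rewrite oppr_eq0 => /eqP -> t0.
by apply/le_anti; rewrite t0 trunc_product_ge0.
Qed.

(** Exponentiated form of the change of base point: the exponential of the
    Busemann function is the derivative of one visual function with respect to
    the other. *)
Lemma visual_change x y xi eta :
  visual y xi eta ^+ 2 =
  expR (busemann x y xi) * expR (busemann x y eta) * visual x xi eta ^+ 2.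
Proof.
have [->|/eqP neq] := eqVneq xi eta; first by rewrite !visual_diag !expr0n /= mulr0.
rewrite !visual_neq// -!expRM_natl -!expRD; congr expR.
by have := infty_product_change X_tree x y neq; lra.
Qed.

Lemma busemann_continuous x y : continuous (busemann x y).
Proof.
move=> xi; have FF : Filter (nbhs xi) by exact: nbhs_filter.
suff H : fine (ext_product x (Inner y, AtInfinity eta)) @[eta --> xi] -->
    fine (ext_product x (Inner y, AtInfinity xi)).
  by apply: cvgB; [apply: cvgM; [exact: cvg_cst|]|exact: cvg_cst].
apply: fine_cvg; rewrite fineK ?ext_product_inner_fin//.
apply: (@continuous_cvg _ _ _ _ _
  (fun eta => (Inner y, AtInfinity eta)) (ext_product x)).
  exact: ext_product_continuous.
exact: (cvg_pair (cvg_cst _) (@AtInfinity_continuous xi)).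
Qed.

Lemma normr_busemann_le x y xi : `|busemann x y xi| <= mdist x y.
Proof.
have d0 := mdist_ge0 x y.
have := ext_product_trunc X_tree x (Inner y) (AtInfinity xi) d0.
rewrite /busemann (trunc_inner_id X_tree)// => -> /=.
have := trunc_product_le X_tree x (Inner y) (AtInfinity xi) d0.
have := trunc_product_ge0 x (mdist x y) (Inner y) (AtInfinity xi).
by move=> *; rewrite ler_norml; apply/andP; split; lra.
Qed.

Lemma visual_separating x : separating (visual x).
Proof.
split.
- move=> [xi eta]; rewrite /continuous_at /=.
  have fst_cvg : AtInfinity p.1 @[p --> (xi, eta)] --> AtInfinity xi.
    by apply: (@continuous_cvg _ _ _ _ _ fst);
      [exact: AtInfinity_continuous|exact: cvg_fst].
  have snd_cvg : AtInfinity p.2 @[p --> (xi, eta)] --> AtInfinity eta.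
    by apply: (@continuous_cvg _ _ _ _ _ snd);
      [exact: AtInfinity_continuous|exact: cvg_snd].
  under eq_fun do rewrite visualE; rewrite visualE.
  apply: cvg_expeRN; first exact: ext_product_ge0.
  apply: (@continuous_cvg _ _ _ _ _
    (fun p : boundary X * boundary X => (AtInfinity p.1, AtInfinity p.2))).
    exact: ext_product_continuous.
  exact: (cvg_pair fst_cvg snd_cvg).
- exact: visual_ge0.
- exact: visualC.
- move=> xi eta; split=> [v0|->]; last exact: visual_diag.
  by apply: contrapT => /(visual_gt0 x); rewrite v0 ltxx.
Qed.

Context (X_complete : geodesically_complete X).

(** Prolong an initial segment of the ray from x to xi backwards beyond x, and
    follow the prolongation to infinity. *)
Lemma exists_antipode x xi : exists eta, visual x xi eta = 1.
Proof.
have [c [c0 xic cE]] := trunc_ray X_tree x xi; have cR := rays_to_ray xic.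
have cI : isometric_on `[0, 1] c.
  by move=> s t /=; rewrite !in_itv /= => /andP[s0 _] /andP[t0 _]; rewrite ray_dist.
have [g gI gc] := X_complete ler01 cI.
have hR : is_ray (fun t => g (- t)).
  by move=> s t _ _; rewrite gI// distrC; congr (`| _ |); lra.
have [eta etah] := exists_endpoint hR; exists eta.
have g0 : g 0 = x by rewrite -gc ?c0// in_itv /= lexx ler01.
have g1 : g 1 = c 1 by rewrite -gc// in_itv /= lexx ler01.
(* at scale 1 the two truncations are g 1 and g (- 1), which are 2 apart *)
apply/(visual_eq1 _ _ _ ltr01); rewrite /trunc_product cE//.
rewrite (@trunc_eq _ _ X_tree x 1 (AtInfinity eta) (g (- 1)))//; last first.
  by exists (fun t => g (- t)); rewrite oppr0.
rewrite -g0 -g1 /gromov_product !gI//.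
rewrite !sub0r opprK normrN normr1 ger0_norm; lra.
Qed.

(** Prolong the geodesic from x to y beyond y; y then lies on the ray from x. *)
Lemma exists_busemann_max x y : exists xi, busemann x y xi = mdist x y.
Proof.
have [c [cI c0 cl]] := X_tree.1 x y.
have d0 := mdist_ge0 x y; have [g gI gc] := X_complete d0 cI.
have gR : is_ray g by move=> s t _ _; exact: gI.
have [xi xig] := exists_endpoint gR; exists xi.
have yE : y = trunc x (mdist x y) (AtInfinity xi).
  apply/esym/trunc_eq => //; exists g.
  by split=> //; rewrite -gc ?in_itv /= ?lexx ?d0.
rewrite /busemann {1}yE ext_product_trunc// trunc_product_infty//=; lra.
Qed.

Lemma visual_antipodal x : boundary X -> antipodal (visual x).
Proof.
move=> xi0; split; [exact: visual_separating| |exact: exists_antipode].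
have [eta v1] := exists_antipode x xi0.
apply/le_anti/andP; split.
  apply: ge_sup; first by exists (visual x xi0 eta), (xi0, eta).
  by move=> _ [p _ <-]; exact: visual_le1.
rewrite -{1}v1; apply: ub_le_sup; last by exists (xi0, eta).
by exists 1 => _ [p _ <-]; exact: visual_le1.
Qed.

End Visual.

(** * Moebius equivalence and antipodal functions *)

Section MoebiusEquivalence.
Context {R : realType} {Z : topologicalType}.
Context (four_points : exists f : 'I_4 -> Z, injective f).
Implicit Types (rho : Z -> Z -> R) (f g : Z -> R).

Lemma exists_notin (s : seq Z) : (size s < 4)%N -> exists z, z \notin s.
Proof.
move=> s4; have [f finj] := four_points; apply: contrapT => H.
have fs : {subset [seq f i | i <- enum 'I_4] <= s}.
  by move=> _ /mapP[i _ ->]; apply/negP => fi; apply: H; exists (f i); apply/negP.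
have := uniq_leq_size (_ : uniq _) fs.
rewrite map_inj_uniq// enum_uniq size_map size_enum_ord => /(_ isT).
by rewrite leqNgt s4.
Qed.

Lemma separating_gt0 rho a b : separating rho -> a != b -> 0 < rho a b.
Proof.
by case=> _ r0 _ rE ab; rewrite lt_def r0 andbT; apply: contra_neq ab => /rE.
Qed.

Lemma derivative_moebius rho1 rho2 f :
  separating rho1 -> separating rho2 -> (forall a, 0 < f a) ->
  (forall a b, rho2 a b ^+ 2 = f a * f b * rho1 a b ^+ 2) ->
  moebius_equivalent rho1 rho2.
Proof.
move=> sep1 sep2 f0 fE a b c d /= U.
have {U}[ac bc ad bd] : [/\ a != c, b != c, a != d & b != d].
  by move: U; rewrite !inE !negb_or => /and4P[/and3P[_ -> ->] /andP[-> ->]].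
have pos rho : separating rho -> 0 < cross_ratio rho a b c d.
  by move=> sep; rewrite divr_gt0 ?mulr_gt0 ?separating_gt0.
apply/eqP; rewrite -(@eqrXn2 _ 2) ?(ltW (pos _ _))//; apply/eqP.
rewrite /cross_ratio !expr_div_n !exprMn !fE.
have := separating_gt0 sep1 ad; have := separating_gt0 sep1 bc.
move: (f0 a) (f0 b) (f0 c) (f0 d) => a0 b0 c0 d0 rbc rad.
by field; rewrite !gt_eqF.
Qed.

(** With three distinct points, f a is recovered from the products on pairs:
    f a ^ 2 = (f b f a) (f c f a) / (f c f b). *)
Lemma derivative_uniq f g : (forall a, 0 < f a) -> (forall a, 0 < g a) ->
  (forall a b, a != b -> f a * f b = g a * g b) -> f = g.
Proof.
move=> f0 g0 fg; apply/funext => a.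
have [b] := @exists_notin [:: a] isT; rewrite inE => ba.
have [c] := @exists_notin [:: a; b] isT; rewrite !inE negb_or => /andP[ca cb].
apply/eqP; rewrite -(@eqrXn2 _ 2) ?(ltW (f0 _)) ?(ltW (g0 _))//; apply/eqP.
have sq (h : Z -> R) : (forall a, 0 < h a) ->
    h a ^+ 2 = (h b * h a) * (h c * h a) / (h c * h b).
  by move=> h0; field; rewrite !gt_eqF.
by rewrite !sq// !fg.
Qed.

(** Put m = rho2 / rho1. The derivative at a has to be m(a, b) m(a, c) / m(b, c)
    for any b and c such that a, b, c are distinct. Equality of the cross-ratios
    allows one of b, c to be replaced by a fourth point, hence both, so the value
    does not depend on them; computing it at a with b, c and at b with a, c gives
    f a f b = m(a, b) ^ 2. *)
Lemma moebius_derivative rho1 rho2 :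
  separating rho1 -> separating rho2 -> moebius_equivalent rho1 rho2 ->
  exists2 f, forall a, 0 < f a &
    forall a b, rho2 a b ^+ 2 = f a * f b * rho1 a b ^+ 2.
Proof.
move=> sep1 sep2 eq12; pose m a b := rho2 a b / rho1 a b.
have m0 a b : a != b -> 0 < m a b.
  by move=> ab; rewrite divr_gt0 ?separating_gt0.
have mC a b : m a b = m b a.
  by case: sep1 sep2 => _ _ C1 _ [_ _ C2 _]; rewrite /m C1 C2.
have cross a b c d : uniq [:: a; b; c; d] -> m a c * m b d = m a d * m b c.
  move=> U; have := eq12 _ _ _ _ U.
  have {U}[ac bc ad bd] : [/\ a != c, b != c, a != d & b != d].
    by move: U; rewrite /= !inE !negb_or => /and4P[/and3P[_ -> ->] /andP[-> ->]].
  rewrite /cross_ratio /m => E.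
  have n1 x y : x != y -> rho1 x y != 0.
    by move=> xy; rewrite lt0r_neq0// separating_gt0.
  have n2 x y : x != y -> rho2 x y != 0.
    by move=> xy; rewrite lt0r_neq0// separating_gt0.
  move/eqP: E; rewrite eqr_div ?mulf_neq0 ?n1 ?n2// => /eqP E.
  by apply/eqP; rewrite !mulf_div eqr_div ?mulf_neq0 ?n1// -E mulrC.
pose v a b c := m a b * m a c / m b c.
have vC a b c : v a b c = v a c b by rewrite /v (mC c b) (mulrC (m a c)).
have v_step a b c d : uniq [:: a; b; c; d] -> v a b c = v a b d.
  move=> U; have := cross _ _ _ _ U.
  have {U}[bc bd] : [/\ b != c & b != d].
    by move: U; rewrite /= !inE !negb_or => /and4P[_ /andP[-> ->]].
  rewrite /v => E; apply/eqP; rewrite eqr_div ?lt0r_neq0 ?m0//.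
  by rewrite -(mulrA (m a b)) E mulrA.
(* exchange one auxiliary point at a time *)
have v_indep a b c b' c' : uniq [:: a; b; c] -> uniq [:: a; b'; c'] ->
    v a b c = v a b' c'.
  have v_half d d1 d2 : uniq [:: a; d; d1] -> uniq [:: a; d; d2] ->
      v a d d1 = v a d d2.
    have [->//|d12] := eqVneq d1 d2.
    rewrite /= !inE !negb_or => /and3P[/andP[ad ad1] dd1 _].
    move=> /and3P[/andP[_ ad2] dd2 _].
    by apply: v_step; rewrite /= !inE !negb_or ad ad1 ad2 dd1 dd2 d12.
  have uC d d' : uniq [:: a; d; d'] = uniq [:: a; d'; d].
    by rewrite /= !inE !negb_or (eq_sym d) (andbC (a != d)).
  move=> U U'.
  have [b'b|b'b] := eqVneq b' b; first by subst b'; exact: v_half.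
  have [b'c|b'c] := eqVneq b' c.
    by subst b'; rewrite vC; apply: v_half => //; rewrite uC.
  have bb' : uniq [:: a; b; b'].
    move: U U'; rewrite /= !inE !negb_or => /and3P[/andP[-> _] _ _].
    move=> /and3P[/andP[-> _] _ _].
    by rewrite eq_sym b'b.
  by rewrite (v_half b c b')// vC; apply: v_half => //; rewrite uC.
have third (a : Z) : exists bc : Z * Z, uniq [:: a; bc.1; bc.2].
  have [b] := @exists_notin [:: a] isT; rewrite inE => ba.
  have [c] := @exists_notin [:: a; b] isT; rewrite !inE negb_or => /andP[ca cb].
  by exists (b, c); rewrite /= !inE !negb_or !(eq_sym a) ba ca eq_sym cb.
have [bc bcU] := boolp.choice third.
exists (fun a => v a (bc a).1 (bc a).2).
  move=> a; move: (bcU a); rewrite /= !inE !negb_or => /and3P[/andP[ab ac] bc' _].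
  by apply: divr_gt0; first apply: mulr_gt0; exact: m0.
move=> a b; have [->|ab] := eqVneq a b.
  by case: sep1 sep2 => _ _ _ E1 [_ _ _ E2];
    rewrite (E1 b b).2// (E2 b b).2// expr0n mulr0.
have [c] := @exists_notin [:: a; b] isT; rewrite !inE negb_or => /andP[ca cb].
have abc : uniq [:: a; b; c] by rewrite /= !inE negb_or ab !(eq_sym _ c) ca cb.
have bac : uniq [:: b; a; c] by rewrite /= !inE negb_or eq_sym ab !(eq_sym _ c) ca cb.
rewrite (v_indep _ _ _ _ _ (bcU a) abc) (v_indep _ _ _ _ _ (bcU b) bac).
have -> : rho2 a b ^+ 2 = m a b ^+ 2 * rho1 a b ^+ 2.
  by rewrite /m expr_div_n divfK// expf_neq0// gt_eqF// separating_gt0.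
congr (_ * _); rewrite /v (mC b a).
have ac0 : 0 < m a c by rewrite m0// eq_sym.
have bc0 : 0 < m b c by rewrite m0// eq_sym.
by field; rewrite !gt_eqF.
Qed.

(** The supremum of an unbounded set is 0 by convention, so a supremum equal to 1
    is a bound. *)
Lemma antipodal_le1 rho a b : antipodal rho -> rho a b <= 1.
Proof.
case=> _ s1 _; rewrite -s1; apply: ub_le_sup; last by exists (a, b).
apply: contrapT => H; move: s1; rewrite sup_out; last by case.
by move/esym/eqP; rewrite oner_eq0.
Qed.

(** The rigidity behind surjectivity. Let f be the derivative of rho' with respect
    to rho, normalised to be 1 at both ends of a pair that is antipodal for both
    functions. Every b is at rho-distance 1 from one end of the pair, so rho' <= 1
    forces f b <= 1. Since also rho <= 1, a pair antipodal for rho' can only have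
    f a = f b = 1. *)
Lemma antipodal_eq rho rho' f a1 a2 :
  antipodal rho -> antipodal rho' -> (forall a, 0 < f a) ->
  (forall a b, rho' a b ^+ 2 = f a * f b * rho a b ^+ 2) ->
  rho a1 a2 = 1 -> rho' a1 a2 = 1 -> f a1 = 1 ->
  (forall b, rho a1 b = 1 \/ rho b a2 = 1) -> rho' = rho.
Proof.
move=> anti anti' f0 fE r12 r12' fa1 H.
have [[_ r0 _ _] _ _] := anti; have [[_ r0' _ _] _ ex'] := anti'.
have fa2 : f a2 = 1.
  by have := fE a1 a2; rewrite r12 r12' fa1 expr1n mulr1 mul1r.
have le1 a b : rho' a b ^+ 2 <= 1 by rewrite expr_le1 ?antipodal_le1.
have f_le1 b : f b <= 1.
  by case: (H b) => E; [have := le1 a1 b|have := le1 b a2];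
    rewrite fE E ?fa1 ?fa2 expr1n ?mulr1 ?mul1r.
have f1 a : f a = 1.
  apply/le_anti; rewrite f_le1 /=; have [b rb] := ex' a.
  have := fE a b; rewrite rb expr1n => ->.
  rewrite -mulrA ler_piMr ?(ltW (f0 _))//.
  by rewrite mulr_ile1 ?exprn_ge0 ?(ltW (f0 _))// expr_le1 ?antipodal_le1.
apply/funext => a; apply/funext => b; apply/eqP.
by rewrite -(@eqrXn2 _ 2)// fE !f1 !mul1r.
Qed.

End MoebiusEquivalence.

(** * The visual embedding of a tree *)

Section VisualEmbedding.
Context {R : realType} {X : metricType R} (X_tree : metric_tree X).
Implicit Types (x y z : X) (xi eta : boundary X).

(** Beyond the separation time the truncated product is constant, which gives the
    Busemann functions along the two rays explicitly. *)
Lemma trunc_product_infty_product x S xi eta : 0 <= S -> xi <> eta ->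
  trunc_product x S (AtInfinity xi) (AtInfinity eta) =
    Num.min S (infty_product x xi eta).
Proof.
move=> S0 neq; pose T := infty_product x xi eta.
have T0 : 0 <= T by exact: infty_product_ge0.
have ST : S <= S + T + 1 by lra.
have ST0 : 0 <= S + T + 1 by lra.
rewrite (trunc_product_min X_tree x _ _ S0 ST); congr Num.min.
have := le_ext_product x (AtInfinity xi) (AtInfinity eta) ST0.
rewrite -(fineK (ext_product_fin_num X_tree x neq)) lee_fin.
rewrite -/(infty_product _ _ _) -/T => le_T.
have lt_ST : trunc_product x (S + T + 1) (AtInfinity xi) (AtInfinity eta) < S + T + 1.
  by lra.
exact: esym (congr1 fine (ext_product_fin X_tree ST0 lt_ST)).
Qed.

(** On the line from eta to xi the Busemann function of xi is a unit-speed
    parameter, so it takes every real value r. Seen from x the line leaves at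
    T = (xi|eta)_x: the point wanted is on the ray from x to xi when r >= T, and
    on the ray from x to eta otherwise. *)
Lemma exists_line_point x xi eta (r : R) : xi <> eta ->
  exists2 z, visual z xi eta = 1 & busemann x z xi = r.
Proof.
move=> neq; pose T := infty_product x xi eta.
have T0 : 0 <= T by exact: infty_product_ge0.
have neq' : eta <> xi by move=> E; apply: neq.
have TC : infty_product x eta xi = T by rewrite /infty_product ext_productC.
have bus S (zeta zeta' : boundary X) : 0 <= S ->
    busemann x (trunc x S (AtInfinity zeta)) zeta' =
    2 * trunc_product x S (AtInfinity zeta) (AtInfinity zeta') - S.
  by move=> S0; rewrite /busemann ext_product_trunc// mdist_trunc_infty.
suff [z Ezeta zxi] : exists2 z, busemann x z eta = 2 * T - r & busemann x z xi = r.
  exists z => //; rewrite visual_neq//.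
  have := infty_product_change X_tree x z neq; rewrite zxi Ezeta -/T => E.
  have -> : infty_product z xi eta = 0 by lra.
  by rewrite oppr0 expR0.
have [Tr|rT] := leP T r.
  have r0 : 0 <= r by lra.
  exists (trunc x r (AtInfinity xi)); rewrite bus//.
    by rewrite trunc_product_infty_product// -/T min_r.
  by rewrite trunc_product_infty//; lra.
have S0 : 0 <= 2 * T - r by lra.
exists (trunc x (2 * T - r) (AtInfinity eta)); rewrite bus//.
  by rewrite trunc_product_infty//; lra.
by rewrite trunc_product_infty_product// TC min_r; lra.
Qed.

Context (X_complete : geodesically_complete X).
Context (four_points : exists f : 'I_4 -> boundary X, injective f).

Lemma visual_derivative x y :
  is_derivative (visual x) (visual y) (fun xi => expR (busemann x y xi)).
Proof.
split.
- move=> xi; have FF : Filter (nbhs xi) by exact: nbhs_filter.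
  apply: (@continuous_cvg _ _ _ _ _ (busemann x y) expR).
    exact: continuous_expR.
  exact: busemann_continuous.
- by move=> xi; exact: expR_gt0.
- by move=> xi eta; exact: visual_change.
Qed.

Lemma derivative_visual x y :
  derivative (visual x) (visual y) = (fun xi => expR (busemann x y xi)).
Proof.
have E := visual_derivative x y.
have [_ d0 dE] := xgetPex (fun=> 1) (ex_intro _ _ E).
apply: (derivative_uniq four_points d0) => [a|a b ab]; first exact: expR_gt0.
have v0 : 0 < visual x a b ^+ 2 by rewrite exprn_gt0// visual_gt0//; exact/eqP.
apply: (mulIf (lt0r_neq0 v0)).
by rewrite -dE (visual_change X_tree x y).
Qed.

(** The logarithm of the derivative is the Busemann function, which is bounded by
    the distance and attains it at the end of a geodesic through x and y. *)
Lemma moebius_dist_visual x y : moebius_dist (visual x) (visual y) = mdist x y.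
Proof.
rewrite /moebius_dist derivative_visual.
have [xi xiE] := exists_busemann_max X_tree X_complete x y.
have le_d : ubound (range (fun xi => `|ln (expR (busemann x y xi))|)) (mdist x y).
  by move=> _ [eta _ <-]; rewrite expRK normr_busemann_le.
apply/le_anti/andP; split.
  by apply: ge_sup => //; exists `|ln (expR (busemann x y xi))|, xi.
apply: ub_le_sup; first by exists (mdist x y).
by exists xi => //; rewrite expRK xiE ger0_norm// mdist_ge0.
Qed.

Lemma visual_moebius x y : moebius_equivalent (visual x) (visual y).
Proof.
apply: derivative_moebius (visual_change X_tree x y).
- exact: visual_separating.
- exact: visual_separating.
- by move=> xi; exact: expR_gt0.
Qed.

Lemma visual_inj : injective (@visual R X).
Proof.
move=> x y xy; apply: mdist_positivity.
by rewrite -moebius_dist_visual xy moebius_dist_visual mdistxx.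
Qed.

(** If z is on the line from xi to eta, a third point at infinity branches off on
    at most one side of z. *)
Lemma visual_split z xi eta zeta : visual z xi eta = 1 ->
  visual z xi zeta = 1 \/ visual z zeta eta = 1.
Proof.
move=> /(visual_eq1 X_tree _ _ _ ltr01) t0.
have := X_tree.2 z (trunc z 1 (AtInfinity xi)) (trunc z 1 (AtInfinity zeta))
  (trunc z 1 (AtInfinity eta)).
rewrite [leRHS]t0 ge_min => /orP[le0|le0]; [left|right];
  by apply/(visual_eq1 X_tree _ _ _ ltr01)/le_anti; rewrite le0 trunc_product_ge0.
Qed.

(** Take xi and eta with rho(xi, eta) = 1 and the point z of the line from eta to
    xi at which the derivative of rho with respect to visual z is 1 at xi. As the
    product of its values at xi and eta is 1, it is 1 at eta as well. *)
Lemma visual_surj x0 rho : moebius_space (visual x0) rho ->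
  exists z, visual z = rho.
Proof.
move=> [anti eq0]; have [sep _ ex] := anti.
have [f f0 fE] := moebius_derivative four_points (visual_separating X_tree x0) sep eq0.
have [p _] := four_points; pose xi := p ord0; have [eta rho1] := ex xi.
have neq : xi <> eta.
  move=> E; case: sep => _ _ _ /(_ xi eta)[_ /(_ E)].
  by rewrite rho1 => /eqP; rewrite oner_eq0.
have [z z1 zxi] := exists_line_point x0 (ln (f xi)) neq.
exists z; apply/esym.
apply: (@antipodal_eq _ _ _ _ (fun a => f a / expR (busemann x0 z a)) xi eta) => //.
- exact: (visual_antipodal X_tree X_complete z xi).
- by move=> a; rewrite divr_gt0// expR_gt0.
- move=> a b; rewrite fE (visual_change X_tree x0 z).
  by field; rewrite !gt_eqF ?expR_gt0.
- by rewrite zxi lnK ?posrE// divff// gt_eqF.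
- by move=> b; exact: visual_split.
Qed.

End VisualEmbedding.

Theorem corollary8p12 (R : realType) (X : metricType R)
    (X_tree : metric_tree X) (X_proper : proper_space X)
    (X_complete : geodesically_complete X)
    (four_points : exists f : 'I_4 -> boundary X, injective f) :
  forall x0 : X,
    set_bij [set: X] (moebius_space (visual x0)) (@visual R X)
    /\ forall x y : X, moebius_dist (visual x) (visual y) = mdist x y.
Proof.
move=> x0; split; last exact: moebius_dist_visual.
have [f _] := four_points; split.
- move=> x _; split.
    exact: (visual_antipodal X_tree X_complete x (f ord0)).
  exact: visual_moebius.
- by move=> x y _ _; exact: visual_inj.
- by move=> rho /(visual_surj X_tree X_complete four_points)[z <-]; exists z.
Qed.
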